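(* Let $\mathbb{F}_m$ be the last field of a radical tower over $\mathbb{C}(\overline{x})=\mathbb{C}(x_1,\ldots,x_n)$, and consider a PDE \[(\mathrm{A})\qquad F(x_1,\ldots,x_n,y,y_1(\overline{x}),\ldots,y_n(\overline{x}),y_{11}(\overline{x}),\ldots)=0,\] where $F$ is a polynomial in $y$ and its partial derivatives (up to some finite order) with coefficients in $\mathbb{F}_m$. Let $r_1,\ldots,r_n\in\mathbb{C}(z_1,\ldots,z_n)$ be a change of variables, i.e. the Jacobian matrix of $\overline{r}=(r_1,\ldots,r_n)$ is invertible, and let \[(\mathrm{B})\qquad G(r_1(\overline{z}),\ldots,r_n(\overline{z}),Y(\overline{z}),Y_1(\overline{z}),\ldots,Y_n(\overline{z}),Y_{11}(\overline{z}),\ldots)=0\] be the PDE for $Y(\overline{z})=y(\overline{r}(\overline{z}))$ obtained from $(\mathrm{A})$ by the change $x_i=r_i(\overline{z})$, $i=1,\ldots,n$. The following statements are equivalent: \begin{enumerate} \item The PDE $(\mathrm{B})$ is algebraic. \item All the components of the vector $\overline{a}(\overline{r}(\overline{z}))$ are rational, where $\overline{a}(\overline{x})$ is the tuple of the non-rational coefficients of the PDE $(\mathrm{A})$. \end{enumerate}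
   Context: A radical tower over $\mathbb{C}(\overline{x})$ is a chain of fields $\mathbb{F}_0=\mathbb{C}(x_1,\ldots,x_n)\subseteq\dots\subseteq\mathbb{F}_{m}$ with $\mathbb{F}_i=\mathbb{F}_{i-1}(\delta_i)=\mathbb{F}_0(\delta_1,\ldots,\delta_i)$, where $\delta_i^{e_i}=\alpha_i\in\mathbb{F}_{i-1}$ and $e_i\in\mathbb{N}$ is positive. Elements of $\mathbb{F}_m$ are regarded as functions of $\overline{x}$ after a choice of branches of the radicals; for $a\in\mathbb{F}_m$, $a(\overline{r}(\overline{z}))$ denotes the composite function, which is called rational if it is an element of $\mathbb{C}(\overline{z})$. The non-rational coefficients of (A) are the coefficients of $F$, as a polynomial in $y$ and its partial derivatives, that are not in $\mathbb{C}(\overline{x})$. Partial derivatives are denoted with subindices: $y_{i_1\ldots i_s}=\frac{\partial^s y}{\partial x_{i_1}\cdots\partial x_{i_s}}$, and similarly for $Y$ with respect to the $z_i$; equal mixed partials are identified. The equation (B) is obtained by replacing $\overline{x}$ by $\overline{r}(\overline{z})$ in the coefficients of $F$ and replacing the partial derivatives of $y$ evaluated at $\overline{r}(\overline{z})$ by their expressions as linear combinations of the partial derivatives of $Y$, obtained by repeated use of the chain rule: $(y_1(\overline r(\overline z)),\ldots,y_n(\overline r(\overline z)))^T=(J_{\overline{r}}^{T})^{-1}(Y_1(\overline z),\ldots,Y_n(\overline z))^T$, where $J_{\overline{r}}$ is the Jacobian matrix of $\overline{r}$, and iteratively for higher orders. The result is a polynomial expression in $Y$ and its partial derivatives with coefficients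 functions of $\overline{z}$. (B) is called algebraic if all these coefficients are rational functions of $\overline{z}$. *)

(* Defs.v *)
From HB Require Import structures.
From mathcomp Require Import all_boot all_order all_algebra all_field.
From mathcomp Require Export complex mpoly.
From mathcomp Require Import reals classical_sets topology normedtype.

Set Implicit Arguments.
Unset Strict Implicit.
Unset Printing Implicit Defensive.

Import GRing.Theory Num.Theory numFieldNormedType.Exports.
Local Open Scope ring_scope.
Local Open Scope classical_set_scope.

(* The complex numbers are R[i] with R : realType.  The alias R[i]^o only     *)
(* serves to find the norm topology on C and the product topology on C^n.     *)
Notation cspace R n := 'rV[R[i]^o]_n.
Notation cspace_fun R n := (cspace R n -> R[i]^o).
Notation ratfun R n := {fraction {mpoly R[i][n]}}.

Section Functions.
Variables (R : realType) (n : nat).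
Implicit Types (p z : cspace R n) (U V : set (cspace R n)) (q : ratfun R n).

Definition mpoly_val (g : {mpoly R[i][n]}) : cspace_fun R n :=
  fun z => g.@[fun i => z 0 i].

(* The fraction is evaluated through its canonically chosen representative;   *)
(* where that denominator vanishes the value is meaningless.  All identities  *)
(* between functions below are therefore only required generically.           *)
Definition ratfun_val q : cspace_fun R n :=
  fun z => mpoly_val \n_(repr q) z / mpoly_val \d_(repr q) z.

(* P holds on V outside of a proper algebraic hypersurface. *)
Definition generically V (P : cspace R n -> Prop) : Prop :=
  exists2 g : {mpoly R[i][n]}, g != 0 &
    forall z, V z -> mpoly_val g z != 0 -> P z.

Definition cdomain V : Prop := [/\ V !=set0, open V & connected V].

Definition rational_on V (f : cspace_fun R n) : Prop :=
  exists q, generically V (fun z => f z = ratfun_val q z).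

(* Quotient rule; the result does not depend on the representative. *)
Definition pderiv (j : 'I_n) q : ratfun R n :=
  let u := \n_(repr q) in let v := \d_(repr q) in
  tofrac (mderiv j u * v - u * mderiv j v) / tofrac (v ^+ 2).

End Functions.

(* The fields are F_i = F_0(delta_1, ..., delta_i), where 1 is F_0 inside L;  *)
(* the last one is all of L.                                                  *)
Definition radical_tower (F0 : fieldType) (L : fieldExtType F0) (m : nat)
    (delta : m.-tuple L) (e : 'I_m -> nat) : Prop :=
  (forall i : 'I_m, (0 < e i)%N /\
     tnth delta i ^+ e i \in <<1 & take i delta>>%VS) /\
  <<1 & delta>>%VS = fullv.

(* A choice of branches on the domain U: the elements of L become functions   *)
(* that satisfy the algebraic relations of L, extend the rational functions   *)
(* and are continuous (so, being algebraic over C(x), holomorphic) off a      *)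
(* hypersurface, which depends on the elements involved because of poles.     *)
Record branches (R : realType) (n : nat) (L : fieldExtType (ratfun R n))
    (U : set (cspace R n)) (ev : L -> cspace_fun R n) : Prop := Branches {
  branches_domain : cdomain U;
  branches_rat : forall q : ratfun R n,
    generically U (fun p => ev q%:A p = ratfun_val q p);
  branches_add : forall a b : L,
    generically U (fun p => ev (a + b) p = ev a p + ev b p);
  branches_mul : forall a b : L,
    generically U (fun p => ev (a * b) p = ev a p * ev b p);
  branches_cont : forall a : L,
    generically U (fun p => {for p, continuous (ev a)}) }.

Section ChangeOfVariables.
Variables (R : realType) (n : nat) (r : 'I_n -> ratfun R n).

Definition subst_pt : cspace R n -> cspace R n :=
  fun z => \row_i ratfun_val (r i) z.

Definition jacobian_mx : 'M[ratfun R n]_n := \matrix_(i, j) pderiv j (r i).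

(* A linear form \sum_b w_b Y_b in the partial derivatives of Y, with         *)
(* w_b in C(z), is encoded as the polynomial \sum_b w_b 'X_[b]: the monomial  *)
(* 'X_[b] stands for Y_b, and 1 for Y.                                        *)
Definition linform := {mpoly (ratfun R n)[n]}.

(* d/dz_j: Leibniz rule, with d/dz_j Y_b = Y_(b + e_j). *)
Definition dz (j : 'I_n) (w : linform) : linform :=
  map_mpoly (pderiv j) w + w * 'X_j.

(* If w expresses h(r(z)), then dx i w expresses h_i(r(z)). *)
Definition dx (i : 'I_n) (w : linform) : linform :=
  \sum_j invmx jacobian_mx^T i j *: dz j w.

(* The linear form in the Y_b that expresses y_a(r(z)).  The operators dx     *)
(* commute, so the order in which they are applied is immaterial.             *)
Definition chain_rule (a : 'X_{1..n}) : linform :=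
  foldr (fun i w => iter (a i) (dx i) w) 1 (enum 'I_n).

End ChangeOfVariables.

(* Multi-indices of order at most N, hence the partial derivatives of an      *)
(* unknown function up to that order (order 0 being the function itself).     *)
Notation jetidx n N := 'X_{1..n < N.+1}.
Notation jetdim n N := #|{: jetidx n N}|.

Definition jet_idx (n N : nat) (k : 'I_(jetdim n N)) : 'X_{1..n} :=
  bmnm (enum_val k).

Section Equations.
Variables (R : realType) (n N : nat) (L : fieldExtType (ratfun R n)).
Variables (ev : L -> cspace_fun R n) (r : 'I_n -> ratfun R n).

(* In a differential polynomial the variable 'X_k stands for the derivative   *)
(* with multi-index jet_idx k.                                                *)
Implicit Type F : {mpoly L[jetdim n N]}.

Definition nonrational_coefs F : seq L :=
  [seq F@_s | s <- msupp F & F@_s \notin 1%VS].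

Definition composite (a : L) : cspace_fun R n := fun z => ev a (subst_pt r z).

(* y_a(r(z)) in terms of the Y_b, where a = jet_idx k, at the point z. *)
Definition jet_subst (k : 'I_(jetdim n N)) (z : cspace R n) :
    {mpoly R[i][jetdim n N]} :=
  \sum_l ratfun_val (chain_rule r (jet_idx k))@_(jet_idx l) z *: 'X_l.

(* The left-hand side of the transformed equation, a polynomial in the Y_b    *)
(* whose coefficients are functions of z, given by its specialization at z.   *)
Definition transformed F (z : cspace R n) : {mpoly R[i][jetdim n N]} :=
  \sum_(s <- msupp F) composite F@_s z *: \prod_k jet_subst k z ^+ s k.

Definition algebraic_pde (V : set (cspace R n))
    (G : cspace R n -> {mpoly R[i][jetdim n N]}) : Prop :=
  forall s : 'X_{1..jetdim n N}, rational_on V (fun z => (G z)@_s).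

End Equations.

(* Main.v *)
Require Import Defs.
From HB Require Import structures.
From mathcomp Require Import all_boot all_order all_algebra all_field.
From mathcomp Require Import complex mpoly.
From mathcomp Require Import reals classical_sets topology normedtype.
From mathcomp Require Import ring zify.

Set Implicit Arguments.
Unset Strict Implicit.
Unset Printing Implicit Defensive.

Import GRing.Theory Num.Theory numFieldNormedType.Exports.
Local Open Scope ring_scope.
Local Open Scope classical_set_scope.

(** The change of variables acts on the jets of the unknown function by an
    invertible linear map whose entries are rational functions of z, and that
    is the whole reason for the theorem: this map, as a substitution of the jet
    variables, turns (A) with its coefficients composed with r into (B).

    From (2) to (1).  A coefficient of (B) is a polynomial expression, with
    rational coefficients, in the composites a(r(z)) of the coefficients a of
    (A).  The composite of a non-rational coefficient is rational by assumption.
    The composite of a rational coefficient q is q(r(z)), provided that the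
    image of r is not contained in the hypersurface outside of which the
    chosen branch of q agrees with the rational function q.  That is the easy
    half of the Jacobian criterion, [jacobian_alg_indep]: if g(r) = 0 with g of
    minimal degree, then differentiating gives J^T (grad g)(r) = 0, hence
    (grad g)(r) = 0, hence grad g = 0 by minimality, and g is a constant.

    From (1) to (2).  The matrix over C(z) that expresses the y_a(r(z)),
    |a| <= N, in terms of the Y_b, |b| <= N, is invertible ([chain_mx_unit]).
    Indeed modulo derivatives of lower order the chain rule replaces d/dx_i by
    the i-th component of (J^T)^-1 applied to (d/dz_1, ..., d/dz_n), so the
    leading part of this matrix is an invertible linear substitution of the
    variables of a polynomial ring.  Composing (B) with the inverse matrix
    recovers the polynomial in the y_a(r(z)) whose coefficients are the
    composites a(r(z)), and its coefficients are then rational too.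

    All identities between functions of z hold outside of a hypersurface, and a
    finite number of hypersurfaces may be merged into one, so the evaluation of
    rational functions may be handled as if it were a ring morphism. *)

(** * Fractions and the quotient rule *)

Lemma frac_numden (A : idomainType) (q : {fraction A}) :
  q = tofrac \n_(repr q) / tofrac \d_(repr q).
Proof.
have d0 : tofrac \d_(repr q) != 0 :> {fraction A}.
  by rewrite tofrac_eq0 denom_ratioP.
have pi_mul (x : {ratio A}) :
    (\pi_({fraction A})%qT x : {fraction A}) * tofrac \d_x = tofrac \n_x.
  rewrite !piE; apply/eqmodP => /=.
  rewrite FracField.equivfE /FracField.mulf /= !numden_Ratio ?mulf_neq0
    ?oner_neq0 ?denom_ratioP //.
  by rewrite !mulr1 mulrC.
by apply: (canRL (mulfK d0)); rewrite -pi_mul reprK.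
Qed.

Section FractionArithmetic.
Variable A : idomainType.
Local Notation K := {fraction A}.
Implicit Types (u v s t : A) (p q : K).

Lemma frac_eq u v s t : v != 0 -> t != 0 ->
  tofrac u / tofrac v = tofrac s / tofrac t :> K -> u * t = s * v.
Proof.
move=> v0 t0 /eqP; rewrite eqr_div ?tofrac_eq0 //.
by rewrite -!tofracM tofrac_eq => /eqP.
Qed.

Lemma frac_add u v s t : v != 0 -> t != 0 ->
  tofrac (u * t + s * v) / tofrac (v * t) =
  tofrac u / tofrac v + tofrac s / tofrac t :> K.
Proof.
by move=> v0 t0; rewrite tofracD !tofracM -addf_div ?tofrac_eq0.
Qed.

Lemma frac_mul u v s t :
  tofrac (u * s) / tofrac (v * t) =
  (tofrac u / tofrac v) * (tofrac s / tofrac t) :> K.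
Proof. by rewrite !tofracM -mulf_div. Qed.

Lemma addf_numden p q :
  p + q = tofrac (\n_(repr p) * \d_(repr q) + \n_(repr q) * \d_(repr p))
    / tofrac (\d_(repr p) * \d_(repr q)).
Proof. by rewrite frac_add ?denom_ratioP // -!frac_numden. Qed.

Lemma mulf_numden p q :
  p * q = tofrac (\n_(repr p) * \n_(repr q))
    / tofrac (\d_(repr p) * \d_(repr q)).
Proof. by rewrite frac_mul -!frac_numden. Qed.

Lemma invf_numden q : q^-1 = tofrac \d_(repr q) / tofrac \n_(repr q).
Proof. by rewrite {1}(frac_numden q) invf_div. Qed.

Lemma numer_neq0 q : q != 0 -> \n_(repr q) != 0.
Proof.
by apply: contraNneq => n0; rewrite (frac_numden q) n0 tofrac0 mul0r.
Qed.

End FractionArithmetic.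

(** The computations behind [frac_derivD] and [frac_derivM]; primes stand for
    derivatives. *)
Lemma quotient_rule_add (F : fieldType) (u v s t u' v' s' t' : F) :
  v != 0 -> t != 0 ->
  ((u' * t + u * t' + (s' * v + s * v')) * (v * t)
    - (u * t + s * v) * (v' * t + v * t')) / (v * t) ^+ 2 =
  (u' * v - u * v') / v ^+ 2 + (s' * t - s * t') / t ^+ 2.
Proof. by move=> v0 t0; field; rewrite v0 t0. Qed.

Lemma quotient_rule_mul (F : fieldType) (u v s t u' v' s' t' : F) :
  v != 0 -> t != 0 ->
  ((u' * s + u * s') * (v * t) - u * s * (v' * t + v * t')) / (v * t) ^+ 2 =
  (u' * v - u * v') / v ^+ 2 * (s / t) + u / v * ((s' * t - s * t') / t ^+ 2).
Proof. by move=> v0 t0; field; rewrite v0 t0. Qed.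

Section QuotientRule.
Variables (A : idomainType) (D : A -> A).
Hypothesis derivD : {morph D : u v / u + v}.
Hypothesis derivM : forall u v, D (u * v) = D u * v + u * D v.
Local Notation K := {fraction A}.
Implicit Types (q : K) (u v : A).

(** For D = mderiv j this is pderiv j, by conversion. *)
Definition frac_deriv q : K :=
  let u := \n_(repr q) in let v := \d_(repr q) in
  tofrac (D u * v - u * D v) / tofrac (v ^+ 2).

(** The quotient rule gives the same value for every representative: apply the
    derivation to the identity u V = U v between two representatives u / v and
    U / V, and eliminate. *)
Lemma frac_derivE u v : v != 0 ->
  frac_deriv (tofrac u / tofrac v) =
  (tofrac (D u) * tofrac v - tofrac u * tofrac (D v)) / tofrac v ^+ 2.
Proof.
move=> v0; rewrite /frac_deriv; set q := tofrac u / tofrac v.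
have := frac_numden q; move: (denom_ratioP (repr q)).
set U := \n_(repr q); set V := \d_(repr q) => V0 /(frac_eq v0 V0) h1.
have v0F : tofrac v != 0 :> K by rewrite tofrac_eq0.
have V0F : tofrac V != 0 :> K by rewrite tofrac_eq0.
have := congr1 D h1; rewrite !derivM => h2.
apply/eqP; rewrite tofracXn eqr_div ?expf_neq0 //.
rewrite -!tofracM -!tofracB -!tofracXn -!tofracM tofrac_eq -subr_eq0.
(* The claim is a combination of u V = U v and of its derivative. *)
have -> : (D U * V - U * D V) * v ^+ 2 - (D u * v - u * D v) * V ^+ 2 =
   - v * V * ((D u * V + u * D V) - (D U * v + U * D v))
   + (v * D V + V * D v) * (u * V - U * v) by ring.
by rewrite h1 h2 !subrr !mulr0 addr0.
Qed.

Lemma frac_derivD : {morph frac_deriv : p q / p + q}.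
Proof.
move=> p q; rewrite (frac_numden p) (frac_numden q).
set u := \n_(repr p); set v := \d_(repr p).
set s := \n_(repr q); set t := \d_(repr q).
have v0 : v != 0 by apply: denom_ratioP.
have t0 : t != 0 by apply: denom_ratioP.
have v0F : tofrac v != 0 :> K by rewrite tofrac_eq0.
have t0F : tofrac t != 0 :> K by rewrite tofrac_eq0.
rewrite -frac_add // !frac_derivE ?mulf_neq0 //.
rewrite derivD !derivM !(tofracD, tofracM).
exact: quotient_rule_add.
Qed.

Lemma frac_derivM p q :
  frac_deriv (p * q) = frac_deriv p * q + p * frac_deriv q.
Proof.
rewrite (frac_numden p) (frac_numden q).
set u := \n_(repr p); set v := \d_(repr p).
set s := \n_(repr q); set t := \d_(repr q).
have v0 : v != 0 by apply: denom_ratioP.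
have t0 : t != 0 by apply: denom_ratioP.
have v0F : tofrac v != 0 :> K by rewrite tofrac_eq0.
have t0F : tofrac t != 0 :> K by rewrite tofrac_eq0.
rewrite -frac_mul !frac_derivE ?mulf_neq0 //.
rewrite !derivM !(tofracD, tofracM).
exact: quotient_rule_mul.
Qed.

Lemma frac_deriv_const u : D 1 = 0 -> D u = 0 -> frac_deriv (tofrac u) = 0.
Proof.
move=> D1 Du; rewrite -[tofrac u]divr1 -tofrac1 frac_derivE ?oner_neq0 //.
by rewrite D1 Du tofrac0 mulr0 mul0r subrr mul0r.
Qed.

End QuotientRule.

(** * The Jacobian criterion *)

Lemma msize_mderiv n (A : comNzRingType) (i : 'I_n) (g : {mpoly A[n]}) :
  (msize g^`M(i) <= (msize g).-1)%N.
Proof.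
rewrite msizeE; apply/bigmax_leqP_seq => m; rewrite mcoeff_msupp mcoeff_deriv.
move=> gm _; have : g@_(m + U_(i)) != 0.
  by apply: contraNneq gm => ->; rewrite mul0rn.
rewrite -mcoeff_msupp => /msize_mdeg_lt.
by rewrite mdegD mdeg1 addn1; lia.
Qed.

Section JacobianCriterion.
Variables (R : realType) (n : nat).
Local Notation K := (ratfun R n).
Implicit Type g : {mpoly R[i][n]}.

Lemma pderivD j : {morph @pderiv R n j : p q / p + q}.
Proof. exact: (frac_derivD (mderivD j) (mderivM j)). Qed.

Lemma pderivM j (p q : K) : pderiv j (p * q) = pderiv j p * q + p * pderiv j q.
Proof. exact: (frac_derivM (mderivM j)). Qed.

Lemma pderivC j (c : R[i]) : pderiv j (tofrac c%:MP : K) = 0.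
Proof.
apply: (frac_deriv_const (mderivM j)); last exact: mderivC.
by rewrite -mpolyC1 mderivC.
Qed.

Variable r : 'I_n -> K.

Definition ratconst : {rmorphism R[i] -> K} :=
  @tofrac {mpoly R[i][n]} \o @mpolyC n R[i].

Local Notation subst g := (mmap ratconst r g).

(** The chain rule for g(r): such identities are stable under sums and products
    in g, so it is enough to check them on constants and variables. *)
Lemma pderiv_subst j g :
  pderiv j (subst g) = \sum_i subst g^`M(i) * pderiv j (r i).
Proof.
pose P g := pderiv j (subst g) = \sum_i subst g^`M(i) * pderiv j (r i).
have PC c : P c%:MP.
  rewrite /P mmapC /= pderivC big1 // => i _.
  by rewrite mderivC mmap0 mul0r.
have PX i : P 'X_i.
  rewrite /P mmapX mmap1U (bigD1 i) //= mderivX mnm1E eqxx scale1r.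
  rewrite -[X in 'X_[X - _]]addm0 addmC addmK mpolyX0 rmorph1 mul1r.
  rewrite big1 ?addr0 // => k ik.
  by rewrite mderivX mnm1E eq_sym (negbTE ik) scale0r mmap0 mul0r.
have PM g1 g2 : P g1 -> P g2 -> P (g1 * g2).
  rewrite /P => h1 h2; rewrite rmorphM /= pderivM h1 h2.
  have h i : subst (g1 * g2)^`M(i) =
      subst g1^`M(i) * subst g2 + subst g1 * subst g2^`M(i).
    by rewrite mderivM rmorphD !rmorphM /=.
  under [RHS]eq_bigr => i _ do rewrite h.
  move: (subst g1) (subst g2) => s1 s2.
  rewrite mulr_sumr mulr_suml -big_split /=; apply: eq_bigr => i _.
  by ring.
have PD g1 g2 : P g1 -> P g2 -> P (g1 + g2).
  rewrite /P => h1 h2; rewrite rmorphD /= pderivD h1 h2 -big_split /=.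
  by apply: eq_bigr => i _; rewrite mderivD rmorphD mulrDl.
elim/mpolyind: g => [|c m g _ _]; first by rewrite -mpolyC0; apply: (PC).
apply: (PD); rewrite -mul_mpolyC; apply: (PM) => //; rewrite mpolyXE_id.
apply: (big_ind P); [by rewrite -mpolyC1 | exact: PM | move=> i _].
by elim: (m i) => [|k IH]; rewrite ?expr0 -?mpolyC1 // exprS; apply: (PM).
Qed.

(** Rational functions with an invertible Jacobian matrix are algebraically
    independent.  By induction on the size of g: the derivative of g(r) = 0
    shows that the row of the (dg/dx_i)(r) is killed by the Jacobian matrix, so
    all dg/dx_i vanish by induction, and g is constant in characteristic 0. *)
Lemma jacobian_alg_indep (hr : jacobian_mx r \in unitmx) g :
  subst g = 0 -> g = 0.
Proof.
have [k] := ubnP (msize g); elim: k g => // k IH g gk g0.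
have dg i : g^`M(i) = 0.
  have [gs|gs] := leqP (msize g) 0.
    have /eqP -> : g == 0 by rewrite -msize_poly_eq0 -leqn0.
    exact: mderiv0.
  apply: IH.
    by apply: leq_ltn_trans (msize_mderiv i g) _; rewrite -ltnS prednK.
  pose w := \row_i subst g^`M(i).
  have w0 : w *m jacobian_mx r = 0.
    apply/rowP => j; rewrite [RHS]mxE; have <- : pderiv j (subst g) = 0.
      by rewrite g0 -tofrac0 -mpolyC0 pderivC.
    by rewrite mxE pderiv_subst; apply: eq_bigr => l _; rewrite !mxE.
  have : w = 0 by rewrite -[w](mulmxK hr) w0 mul0mx.
  by move/rowP/(_ i); rewrite !mxE.
have gC : g = (g@_0)%:MP.
  apply/mpolyP => m; rewrite mcoeffC.
  have [->|m0] := eqVneq m 0%MM; first by rewrite mulr1.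
  rewrite mulr0; have [i mi] : exists i, m i != 0%N.
    apply/existsP; apply: contraNT m0; rewrite negb_exists => /forallP h.
    by apply/eqP/mnmP => i; rewrite mnm0E; apply/eqP; rewrite -[_ == _]negbK.
  have := congr1 (mcoeff (m - U_(i))) (dg i).
  rewrite mcoeff_deriv mcoeff0 submK ?lep1mP // => /eqP.
  by rewrite mulrn_eq0 /= => /eqP.
move: g0; rewrite gC mmapC /= => /eqP; rewrite tofrac_eq0 => /eqP.
by [].
Qed.

End JacobianCriterion.

(** * Degrees and linear substitutions of the variables *)

Section Degree.
Variables (n : nat) (K : idomainType).
Implicit Types (p q : {mpoly K[n]}) (d : nat).

Lemma leq_msizeD d p q :
  (msize p <= d)%N -> (msize q <= d)%N -> (msize (p + q) <= d)%N.
Proof.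
by move=> hp hq; apply: leq_trans (msizeD_le _ _) _; rewrite geq_max hp hq.
Qed.

Lemma leq_msizeN d p : (msize p <= d)%N -> (msize (- p) <= d)%N.
Proof. by rewrite msizeN. Qed.

Lemma leq_msizeZ d (c : K) p : (msize p <= d)%N -> (msize (c *: p) <= d)%N.
Proof. exact: leq_trans (msizeZ_le _ _). Qed.

Lemma leq_msize_sum d (I : eqType) (s : seq I) (F : I -> {mpoly K[n]}) :
  {in s, forall i, (msize (F i) <= d)%N} ->
  (msize (\sum_(i <- s) F i) <= d)%N.
Proof.
move=> hF; rewrite big_seq; apply: (big_ind (fun p => (msize p <= d)%N)) => //.
  by rewrite msize0.
by move=> p q; apply: leq_msizeD.
Qed.

Lemma leq_msizeM a b p q :
  (msize p <= a)%N -> (msize q <= b.+1)%N -> (msize (p * q) <= a + b)%N.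
Proof.
have [->|p0] := eqVneq p 0; first by rewrite mul0r msize0.
have [->|q0] := eqVneq q 0; first by rewrite mulr0 msize0.
move=> ha hb; rewrite msizeM //.
have := leq_add ha hb; rewrite addnS.
by case: (_ + _)%N.
Qed.

Lemma leq_msizeX d e p :
  (msize p <= e.+1)%N -> (msize (p ^+ d) <= (d * e).+1)%N.
Proof.
move=> hp; elim: d => [|d IH]; first by rewrite expr0 msize1.
by rewrite exprSr mulSn addnC -addSn; apply: leq_msizeM.
Qed.

Lemma leq_msize_prod (k : nat) (F : 'I_k -> {mpoly K[n]}) (e : 'I_k -> nat) :
  (forall i, msize (F i) <= (e i).+1)%N ->
  (msize (\prod_i F i) <= (\sum_i e i).+1)%N.
Proof.
move=> hF; apply: (big_ind2 (fun p m => (msize p <= m.+1)%N)) => //.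
  by rewrite msize1.
by move=> p a q b hp hq; rewrite -addSn; apply: leq_msizeM.
Qed.

Lemma leq_msize_comp (h : n.-tuple {mpoly K[n]}) p :
  (forall i, msize (tnth h i) <= 2)%N -> (msize (p \mPo h) <= msize p)%N.
Proof.
move=> hh; rewrite comp_mpolyE; apply: leq_msize_sum => m mp.
apply: leq_msizeZ; apply: leq_trans (msize_mdeg_lt mp).
rewrite mdegE; apply: leq_msize_prod => i.
by apply: leq_trans (leq_msizeX _ (hh i)) _; rewrite muln1.
Qed.

End Degree.

Section LinearSubstitution.
Variables (k : nat) (K : comNzRingType).
Implicit Types (A B : 'M[K]_k) (p : {mpoly K[k]}).

Definition linsubst A : k.-tuple {mpoly K[k]} :=
  [tuple \sum_j A i j *: 'X_j | i < k].

Lemma tnth_linsubst A i : tnth (linsubst A) i = \sum_j A i j *: 'X_j.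
Proof. by rewrite tnth_mktuple. Qed.

Lemma linsubstM A B p : (p \mPo linsubst A) \mPo linsubst B =
  p \mPo linsubst (A *m B).
Proof.
rewrite [in RHS]comp_mpolyE [p \mPo _]comp_mpolyE raddf_sum /=.
apply: eq_bigr => m _; rewrite comp_mpolyZ rmorph_prod /=; congr (_ *: _).
apply: eq_bigr => i _; rewrite rmorphXn /=; congr (_ ^+ _).
rewrite !tnth_linsubst raddf_sum /=.
under eq_bigr => j _ do
  rewrite comp_mpolyZ comp_mpolyXU -tnth_nth tnth_linsubst scaler_sumr.
rewrite exchange_big /=; apply: eq_bigr => l _; rewrite mxE scaler_suml.
by apply: eq_bigr => j _; rewrite scalerA.
Qed.

Lemma linsubst1 p : p \mPo linsubst 1%:M = p.
Proof.
rewrite -[RHS]comp_mpoly_id; congr (_ \mPo _); apply: eq_from_tnth => i.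
rewrite tnth_linsubst tnth_mktuple (bigD1 i) //= mxE eqxx scale1r.
by rewrite big1 ?addr0 // => j ji; rewrite mxE eq_sym (negbTE ji) scale0r.
Qed.

End LinearSubstitution.

Lemma msize_linsubst k (K : idomainType) (A : 'M[K]_k) i :
  (msize (tnth (linsubst A) i) <= 2)%N.
Proof.
rewrite tnth_linsubst; apply: leq_msize_sum => j _.
by apply: leq_msizeZ; rewrite msizeX mdeg1.
Qed.

(** * Invertibility of the chain rule *)

Section ChainRule.
Variables (R : realType) (n : nat) (r : 'I_n -> ratfun R n).
Local Notation K := (ratfun R n).
Local Notation P := (invmx (jacobian_mx r)^T).
Local Notation ell := (linsubst P).
Implicit Types (w t : linform R n) (a : 'X_{1..n}).

Lemma msize_map_mpoly (f : K -> K) w : (msize (map_mpoly f w) <= msize w)%N.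
Proof.
apply: leq_msize_sum => m mw; rewrite mmap1_id /= mul_mpolyC.
by apply: leq_msizeZ; rewrite msizeX; apply: msize_mdeg_lt.
Qed.

Lemma dxE i w : dx r i w =
  \sum_j P i j *: map_mpoly (pderiv j) w + w * tnth ell i.
Proof.
rewrite tnth_linsubst mulr_sumr -big_split /=; apply: eq_bigr => j _.
by rewrite /dz scalerDr scalerAr.
Qed.

(** As msize is the degree plus one, this says that w and t have degree at most
    d and the same homogeneous component of degree d. *)
Definition leading_form d w t := (msize (w - t) <= d)%N && (msize t <= d.+1)%N.

(** The terms of dx i w in which the coefficients of w are differentiated do not
    have a higher degree than w; the other ones are w times a linear form. *)
Lemma leading_form_dx d i w t :
  leading_form d w t -> leading_form d.+1 (dx r i w) (t * tnth ell i).
Proof.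
case/andP=> hw ht; apply/andP; split; last first.
  by rewrite -[d.+2]addn1; apply: leq_msizeM => //; apply: msize_linsubst.
rewrite dxE -addrA -mulrBl; apply: leq_msizeD.
  apply: leq_msize_sum => j _; apply: leq_msizeZ.
  apply: leq_trans (msize_map_mpoly _ _) _.
  rewrite -[w](subrK t); apply: leq_msizeD => //; exact: leqW.
by rewrite -addn1; apply: leq_msizeM => //; apply: msize_linsubst.
Qed.

Lemma leading_form_chain_rule a :
  leading_form (mdeg a) (chain_rule r a) ('X_[a] \mPo ell).
Proof.
rewrite comp_mpolyX mdegE /chain_rule.
rewrite -[X in leading_form X]big_enum -[X in leading_form _ _ X]big_enum /=.
elim: (enum 'I_n) => [|i s IH] /=.
  rewrite !big_nil; apply/andP; split; first by rewrite subrr msize0.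
  by rewrite msize1.
rewrite !big_cons mulrC addnC.
elim: (a i) => [|k IHk] /=; first by rewrite expr0 mulr1 addn0.
by rewrite exprSr mulrA addnS; apply: leading_form_dx.
Qed.

Definition chain_mx N : 'M[K]_(jetdim n N) :=
  \matrix_(k, l) (chain_rule r (jet_idx k))@_(jet_idx l).

Lemma jet_idx_inj N : injective (@jet_idx n N).
Proof. by move=> k l /val_inj /enum_val_inj. Qed.

Lemma jet_idxP N a :
  (mdeg a <= N)%N -> exists k : 'I_(jetdim n N), jet_idx k = a.
Proof.
move=> aN; exists (enum_rank (BMultinom (aN : mdeg a < N.+1)%N)).
by rewrite /jet_idx enum_rankK.
Qed.

Lemma mdeg_jet_idx N (k : 'I_(jetdim n N)) : (mdeg (jet_idx k) <= N)%N.
Proof. exact: bmdeg (enum_val k). Qed.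

(** A relation between the rows of the matrix is a polynomial p that vanishes
    when every monomial 'X_[a] is replaced by the linear form of y_a.  Then the
    composite of p with the invertible substitution ell would have a smaller
    degree than p, so p = 0. *)
Lemma chain_mx_unit (hr : jacobian_mx r \in unitmx) N : chain_mx N \in unitmx.
Proof.
rewrite -row_free_unit; apply: inj_row_free => v vM.
pose p : {mpoly K[n]} := \sum_k v 0 k *: 'X_[jet_idx k].
have pE k : p@_(jet_idx k) = v 0 k.
  rewrite /p raddf_sum /= (bigD1 k) //= mcoeffZ mcoeffX eqxx mulr1.
  rewrite big1 ?addr0 // => l lk; rewrite mcoeffZ mcoeffX.
  by rewrite (inj_eq (@jet_idx_inj N)) (negbTE lk) mulr0.
suff p0 : p = 0 by apply/rowP => k; rewrite mxE -pE p0 mcoeff0.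
have Tp0 : \sum_k v 0 k *: chain_rule r (jet_idx k) = 0.
  apply/mpolyP => a; rewrite mcoeff0 raddf_sum /=.
  have [aN|aN] := leqP (mdeg a) N.
    have [l <-] := jet_idxP aN.
    have /rowP/(_ l) := vM; rewrite !mxE => {2}<-.
    by apply: eq_bigr => k _; rewrite mcoeffZ mxE.
  apply: big1 => k _; rewrite mcoeffZ memN_msupp_eq0 ?mulr0 //.
  (* The linear form of y_b, |b| <= N, has no term of order greater than N. *)
  apply: msize_mdeg_ge.
  have /andP[h1 h2] := leading_form_chain_rule (jet_idx k).
  apply: leq_trans (_ : (mdeg (jet_idx k)).+1 <= _)%N; last first.
    by apply: leq_ltn_trans aN; apply: mdeg_jet_idx.
  rewrite -[chain_rule _ _](subrK ('X_[jet_idx k] \mPo ell)).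
  by apply: leq_msizeD => //; apply: leqW.
have lt_lead : (msize (p \mPo ell) <= (msize p).-1)%N.
  have -> : p \mPo ell =
      - \sum_k v 0 k *:
          (chain_rule r (jet_idx k) - ('X_[jet_idx k] \mPo ell)).
    under eq_bigr => k _ do rewrite scalerBr.
    rewrite sumrB Tp0 sub0r opprK raddf_sum /=.
    by apply: eq_bigr => k _; rewrite comp_mpolyZ.
  apply: leq_msizeN; apply: leq_msize_sum => k _.
  have [->|vk] := eqVneq (v 0 k) 0; first by rewrite scale0r msize0.
  apply: leq_msizeZ; have /andP[+ _] := leading_form_chain_rule (jet_idx k).
  move=> /leq_trans; apply; rewrite -ltnS.
  have : jet_idx k \in msupp p by rewrite mcoeff_msupp pE.
  by move=> /msize_mdeg_lt kp; rewrite prednK //; apply: leq_trans kp.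
have le_lead : (msize p <= msize (p \mPo ell))%N.
  have PJ : P *m (jacobian_mx r)^T = 1%:M by rewrite mulVmx ?unitmx_tr.
  rewrite -[X in (msize X <= _)%N]linsubst1 -PJ.
  by rewrite -linsubstM; apply: leq_msize_comp => i; apply: msize_linsubst.
apply/eqP; rewrite -msize_poly_eq0 -leqn0 leqNgt; apply/negP => sp.
by have := leq_trans le_lead lt_lead; rewrite -ltnS prednK // ltnn.
Qed.

End ChainRule.

(** * Functions that agree generically with a rational function *)

Section Generically.
Variables (R : realType) (n : nat) (V : set (cspace R n)).
Local Notation K := (ratfun R n).
Implicit Types (P Q : cspace R n -> Prop) (q : K) (f g : cspace_fun R n).
Implicit Types (u v : {mpoly R[i][n]}).
(* The evaluation of polynomials; a projection of their type has this name too. *)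
Local Notation mpoly_val := (@Defs.mpoly_val R n).

Lemma generically_mono P Q :
  (forall z, V z -> P z -> Q z) -> generically V P -> generically V Q.
Proof. by move=> PQ [u u0 uP]; exists u => // z Vz uz; apply/PQ/uP. Qed.

Lemma generically_true P : (forall z, P z) -> generically V P.
Proof. by move=> hP; exists 1; rewrite ?oner_neq0. Qed.

Lemma generically_neq0 u :
  u != 0 -> generically V (fun z => mpoly_val u z != 0).
Proof. by exists u. Qed.

Lemma generically_and P Q : generically V P -> generically V Q ->
  generically V (fun z => P z /\ Q z).
Proof.
move=> [u u0 uP] [v v0 vQ]; exists (u * v); first by rewrite mulf_neq0.
move=> z Vz; rewrite /mpoly_val mevalM mulf_eq0 negb_or => /andP[uz vz].
by split; [apply: uP | apply: vQ].
Qed.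

Lemma generically_mono2 P Q (S : cspace R n -> Prop) :
  (forall z, V z -> P z -> Q z -> S z) ->
  generically V P -> generically V Q -> generically V S.
Proof.
move=> PQS gP gQ; apply: generically_mono (generically_and gP gQ).
by move=> z Vz [? ?]; apply: PQS.
Qed.

Lemma generically_all (I : finType) (P : I -> cspace R n -> Prop) :
  (forall i, generically V (P i)) -> generically V (fun z => forall i, P i z).
Proof.
move=> gP; suff : generically V (fun z => forall i, i \in enum I -> P i z).
  by apply: generically_mono => z _ h i; apply: h; rewrite mem_enum.
elim: (enum I) => [|i s IH]; first exact: generically_true.
apply: generically_mono2 (gP i) IH => z _ Piz sz j.
by rewrite inE => /predU1P[->//|]; apply: sz.
Qed.

(** Unlike rational_on, this keeps track of the rational function, so that the
    field operations on both sides can be matched. *)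
Definition represents q f : Prop :=
  generically V (fun z => f z = ratfun_val q z).

Lemma eq_represents q f g :
  generically V (fun z => f z = g z) -> represents q f -> represents q g.
Proof. by apply: generically_mono2 => z _ <-. Qed.

Lemma represents_ext q f g : f =1 g -> represents q f -> represents q g.
Proof. by move=> fg; apply: eq_represents; apply: generically_true. Qed.

Lemma represents_val q : represents q (ratfun_val q).
Proof. exact: generically_true. Qed.

(** Any two representatives of a fraction have the same value wherever both
    denominators are nonzero, so the choice of one is immaterial. *)
Lemma represents_frac u v : v != 0 ->
  represents (tofrac u / tofrac v) (fun z => mpoly_val u z / mpoly_val v z).
Proof.
move=> v0; rewrite /represents /ratfun_val.
set q := tofrac u / tofrac v; have b0 := denom_ratioP (repr q).
have e := frac_eq v0 b0 (frac_numden q).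
apply: generically_mono2 (generically_neq0 v0) (generically_neq0 b0).
move=> z _ vz bz; apply/eqP; rewrite eqr_div // /mpoly_val -!mevalM.
by rewrite e.
Qed.

Lemma represents_poly u : represents (tofrac u) (mpoly_val u).
Proof.
have := represents_frac u (oner_neq0 _); rewrite tofrac1 divr1.
by apply: represents_ext => z; rewrite /mpoly_val meval1 divr1.
Qed.

Lemma represents_const (c : R[i]) : represents (ratconst R n c) (fun=> c).
Proof.
apply: represents_ext (represents_poly c%:MP) => z.
by rewrite /mpoly_val mevalC.
Qed.

Lemma representsD p q f g : represents p f -> represents q g ->
  represents (p + q) (fun z => f z + g z).
Proof.
move=> hf hg; have b0 := denom_ratioP (repr p).
have d0 := denom_ratioP (repr q).
rewrite addf_numden.
apply: eq_represents (represents_frac _ (mulf_neq0 b0 d0)).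
have gz := generically_and (generically_neq0 b0) (generically_neq0 d0).
apply: generically_mono2 (generically_and hf hg) gz.
move=> z _ [-> ->] [bz dz]; rewrite /ratfun_val addf_div //.
by rewrite /mpoly_val mevalD !mevalM.
Qed.

Lemma representsM p q f g : represents p f -> represents q g ->
  represents (p * q) (fun z => f z * g z).
Proof.
move=> hf hg; have b0 := denom_ratioP (repr p).
have d0 := denom_ratioP (repr q).
rewrite mulf_numden.
apply: eq_represents (represents_frac _ (mulf_neq0 b0 d0)).
apply: generically_mono2 hf hg => z _ -> ->.
by rewrite /ratfun_val mulf_div /mpoly_val !mevalM.
Qed.

(** For q = 0 this relies on 0^-1 = 0, in the field of fractions and in C. *)
Lemma representsV q f : represents q f -> represents q^-1 (fun z => (f z)^-1).
Proof.
move=> hf; have [q0|q0] := eqVneq q 0.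
  have r0 := represents_poly 0; move: hf; rewrite q0 invr0 -tofrac0 => hf.
  apply: eq_represents r0; apply: generically_mono2 hf (represents_poly 0).
  by move=> z _ -> <-; rewrite /mpoly_val meval0 invr0.
rewrite invf_numden; apply: eq_represents (represents_frac _ (numer_neq0 q0)).
by apply: generically_mono hf => z _ ->; rewrite /ratfun_val invf_div.
Qed.

Lemma generically_ratfun_neq0 q :
  q != 0 -> generically V (fun z => ratfun_val q z != 0).
Proof.
move=> q0; apply: generically_mono2 (generically_neq0 (numer_neq0 q0))
  (generically_neq0 (denom_ratioP (repr q))) => z _ nz dz.
by rewrite /ratfun_val mulf_neq0 // invr_neq0.
Qed.

Lemma represents_sum (I : Type) (s : seq I) (Q : I -> K)
    (F : I -> cspace_fun R n) :
  (forall i, represents (Q i) (F i)) ->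
  represents (\sum_(i <- s) Q i) (fun z => \sum_(i <- s) F i z).
Proof.
move=> h; elim: s => [|i s IH].
  rewrite big_nil -(rmorph0 (ratconst R n)).
  by apply: represents_ext (represents_const 0) => z; rewrite big_nil.
rewrite big_cons; apply: represents_ext (representsD (h i) IH) => z.
by rewrite big_cons.
Qed.

Lemma represents_prod (I : Type) (s : seq I) (Q : I -> K)
    (F : I -> cspace_fun R n) :
  (forall i, represents (Q i) (F i)) ->
  represents (\prod_(i <- s) Q i) (fun z => \prod_(i <- s) F i z).
Proof.
move=> h; elim: s => [|i s IH].
  rewrite big_nil -(rmorph1 (ratconst R n)).
  by apply: represents_ext (represents_const 1) => z; rewrite big_nil.
rewrite big_cons; apply: represents_ext (representsM (h i) IH) => z.
by rewrite big_cons.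
Qed.

Lemma representsX k q f : represents q f ->
  represents (q ^+ k) (fun z => f z ^+ k).
Proof.
move=> h; elim: k => [|k IH].
  rewrite expr0 -(rmorph1 (ratconst R n)).
  by apply: represents_ext (represents_const 1) => z; rewrite expr0.
rewrite exprS; apply: represents_ext (representsM h IH) => z.
by rewrite exprS.
Qed.

End Generically.

(** * Polynomials whose coefficients are generically rational functions *)

Section RationalFunctions.
Variables (R : realType) (n : nat) (V : set (cspace R n)).
Implicit Types f g : cspace_fun R n.

Lemma eq_rational_on f g : generically V (fun z => f z = g z) ->
  rational_on V f -> rational_on V g.
Proof. by move=> fg [q hq]; exists q; apply: eq_represents hq. Qed.

Lemma rational_onM f g : rational_on V f -> rational_on V g ->
  rational_on V (fun z => f z * g z).
Proof. by move=> [p hp] [q hq]; exists (p * q); exact: (representsM hp hq). Qed.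

Lemma rational_on_sum (I : eqType) (s : seq I) (P : pred I)
    (F : I -> cspace_fun R n) :
  {in s, forall i, rational_on V (F i)} ->
  rational_on V (fun z => \sum_(i <- s | P i) F i z).
Proof.
elim: s => [|i s IH] h.
  exists (ratconst R n 0).
  by apply: represents_ext (represents_const V 0) => z; rewrite big_nil.
have [q hq] : rational_on V (fun z => \sum_(i <- s | P i) F i z).
  by apply: IH => j js; apply: h; rewrite inE js orbT.
have [p hp] := h i (mem_head _ _).
exists (if P i then p + q else q); case: ifP => Pi.
  by apply: represents_ext (representsD hp hq) => z; rewrite big_cons Pi.
by apply: represents_ext hq => z; rewrite big_cons Pi.
Qed.

Variable N : nat.
Local Notation jetpoly := {mpoly R[i][jetdim n N]}.
Implicit Types F G : cspace R n -> jetpoly.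

Lemma eq_algebraic F G : generically V (fun z => F z = G z) ->
  algebraic_pde V F -> algebraic_pde V G.
Proof.
move=> FG hF s; apply: eq_rational_on (hF s).
by apply: generically_mono FG => z _ ->.
Qed.

Lemma algebraic_const (p : jetpoly) : algebraic_pde V (fun=> p).
Proof. by move=> s; exists (ratconst R n p@_s); apply: represents_const. Qed.

Lemma algebraic_sum (I : eqType) (s : seq I) (F : I -> cspace R n -> jetpoly) :
  {in s, forall i, algebraic_pde V (F i)} ->
  algebraic_pde V (fun z => \sum_(i <- s) F i z).
Proof.
move=> h t; apply: eq_rational_on (rational_on_sum predT _).
  by apply: generically_true => z; rewrite raddf_sum.
by move=> i si; apply: h.
Qed.

Lemma algebraicZ f F : rational_on V f -> algebraic_pde V F ->
  algebraic_pde V (fun z => (f z : R[i]) *: F z).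
Proof.
move=> hf hF s; apply: eq_rational_on (rational_onM hf (hF s)).
by apply: generically_true => z; rewrite mcoeffZ.
Qed.

(** A coefficient of a product is a finite sum whose index set depends only on
    the monomial, not on the point z. *)
Lemma algebraicM F G : algebraic_pde V F -> algebraic_pde V G ->
  algebraic_pde V (fun z => F z * G z).
Proof.
move=> hF hG s; apply: (eq_rational_on (f := fun z =>
   \sum_(k : 'X_{1..(jetdim n N) < (mdeg s).+1, (mdeg s).+1} |
        s == (k.1 + k.2)%MM) ((F z)@_k.1 * (G z)@_k.2))).
  by apply: generically_true => z; rewrite mcoeffM.
by apply: rational_on_sum => k _; apply: rational_onM.
Qed.

Lemma algebraicX k F :
  algebraic_pde V F -> algebraic_pde V (fun z => F z ^+ k).
Proof.
move=> hF; elim: k => [|k IH]; first exact: algebraic_const.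
apply: eq_algebraic (algebraicM hF IH).
by apply: generically_true => z; rewrite exprS.
Qed.

Lemma algebraic_prod (I : Type) (s : seq I) (F : I -> cspace R n -> jetpoly) :
  (forall i, algebraic_pde V (F i)) ->
  algebraic_pde V (fun z => \prod_(i <- s) F i z).
Proof.
move=> h; elim: s => [|i s IH].
  apply: eq_algebraic (algebraic_const 1).
  by apply: generically_true => z; rewrite big_nil.
apply: eq_algebraic (algebraicM (h i) IH).
by apply: generically_true => z; rewrite big_cons.
Qed.

Definition eval_mx (M : 'M[ratfun R n]_(jetdim n N)) (z : cspace R n) :
    'M[R[i]]_(jetdim n N) :=
  \matrix_(k, l) ratfun_val (M k l) z.

Lemma algebraic_linsubst M k :
  algebraic_pde V (fun z => tnth (linsubst (eval_mx M z)) k).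
Proof.
apply: (eq_algebraic (F := fun z =>
    \sum_l (ratfun_val (M k l) z : R[i]) *: 'X_l)).
  apply: generically_true => z; rewrite tnth_linsubst.
  by apply: eq_bigr => l _; rewrite mxE.
apply: algebraic_sum => l _; apply: algebraicZ (algebraic_const _).
by exists (M k l); apply: represents_val.
Qed.

(** The uniform bound on the degree makes the composite a sum over a set of
    monomials that does not depend on z. *)
Lemma algebraic_comp_linsubst d M G : (forall z, (msize (G z) <= d)%N) ->
  algebraic_pde V G ->
  algebraic_pde V (fun z => G z \mPo linsubst (eval_mx M z)).
Proof.
move=> Gd hG; apply: (eq_algebraic (F := fun z =>
   \sum_(m : 'X_{1..(jetdim n N) < d})
      (G z)@_m *: \prod_i tnth (linsubst (eval_mx M z)) i ^+ m i)).
  by apply: generically_true => z; rewrite (comp_mpolywE _ (Gd z)).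
apply: algebraic_sum => m _; apply: algebraicZ; first exact: hG.
by apply: algebraic_prod => i; apply/algebraicX/algebraic_linsubst.
Qed.

Lemma generically_eval_mxM (M W : 'M[ratfun R n]_(jetdim n N)) :
  generically V (fun z => eval_mx M z *m eval_mx W z = eval_mx (M *m W) z).
Proof.
have h kl : generically V (fun z =>
    \sum_j ratfun_val (M kl.1 j) z * ratfun_val (W j kl.2) z =
    ratfun_val (\sum_j M kl.1 j * W j kl.2) z).
  apply: represents_sum => j.
  by apply: representsM; apply: represents_val.
apply: generically_mono (generically_all h) => z _ hz.
apply/matrixP => k l; rewrite !mxE; apply: etrans (hz (k, l)).
by apply: eq_bigr => j _; rewrite !mxE.
Qed.

Lemma generically_eval_mx1 : generically V (fun z => eval_mx 1%:M z = 1%:M).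
Proof.
have h (kl : 'I_(jetdim n N) * 'I_(jetdim n N)) :
  generically V (fun z =>
    ((kl.1 == kl.2)%:R : R[i]) = ratfun_val (kl.1 == kl.2)%:R z).
  rewrite -[X in ratfun_val X](rmorph_nat (ratconst R n)).
  exact: represents_const.
apply: generically_mono (generically_all h) => z _ hz.
by apply/matrixP => k l; rewrite !mxE; apply: esym (hz (k, l)).
Qed.

End RationalFunctions.

(** * Composition with the change of variables *)

Section Composition.
Variables (R : realType) (n : nat) (r : 'I_n -> ratfun R n).
Hypothesis hr : jacobian_mx r \in unitmx.
Variables U V : set (cspace R n).
Hypothesis hVU : generically V (fun z => U (subst_pt r z)).
Local Notation subst g := (mmap (ratconst R n) r g).

Lemma represents_subst (g : {mpoly R[i][n]}) :
  represents V (subst g) (fun z => Defs.mpoly_val g (subst_pt r z)).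
Proof.
pose h z : R[i] := \sum_(m <- msupp g) g@_m * \prod_i ratfun_val (r i) z ^+ m i.
apply: (represents_ext (f := h)).
  move=> z; rewrite /Defs.mpoly_val mevalE; apply: eq_bigr => m _.
  by congr (_ * _); apply: eq_bigr => i _; rewrite mxE.
apply: represents_sum => m; apply: representsM; first exact: represents_const.
by apply: represents_prod => i; apply/representsX/represents_val.
Qed.

(** The bad locus g = 0 of P pulls back to g(r) = 0, which is a proper
    hypersurface since the components of r are algebraically independent. *)
Lemma generically_subst (P : cspace R n -> Prop) :
  generically U P -> generically V (fun z => P (subst_pt r z)).
Proof.
move=> [g g0 gP]; have sg0 : subst g != 0.
  by apply: contraNneq g0 => /(jacobian_alg_indep hr) ->.
apply: generically_mono2 hVU
  (generically_and (represents_subst g) (generically_ratfun_neq0 V sg0)).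
by move=> z _ Uz [gz]; rewrite -gz; apply: gP.
Qed.

Lemma rational_on_subst (q : ratfun R n) :
  rational_on V (fun z => ratfun_val q (subst_pt r z)).
Proof.
exists (subst \n_(repr q) / subst \d_(repr q)).
exact: representsM (represents_subst _) (representsV (represents_subst _)).
Qed.

Lemma rational_on_composite (L : fieldExtType (ratfun R n))
    (ev : L -> cspace_fun R n) (a : L) :
  branches U ev -> a \in 1%VS -> rational_on V (composite ev r a).
Proof.
move=> hev /vlineP[q ->].
apply: eq_rational_on (rational_on_subst q).
by apply: generically_mono (generically_subst (branches_rat hev q)) => z _ <-.
Qed.

End Composition.

(** * The transformed equation *)

Section Transformed.
Variables (R : realType) (n N : nat) (L : fieldExtType (ratfun R n)).
Variables (ev : L -> cspace_fun R n) (r : 'I_n -> ratfun R n).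
Variable F : {mpoly L[jetdim n N]}.

(** The equation (A) at the point r(z), as a polynomial in the y_a(r(z)), which
    are not yet rewritten in terms of the derivatives of Y. *)
Definition pulled_back (z : cspace R n) : {mpoly R[i][jetdim n N]} :=
  \sum_(s <- msupp F) composite ev r F@_s z *: 'X_[s].

Lemma transformedE z : transformed ev r F z =
  pulled_back z \mPo linsubst (eval_mx (chain_mx r N) z).
Proof.
rewrite raddf_sum /=; apply: eq_bigr => s _; rewrite comp_mpolyZ comp_mpolyX.
congr (_ *: _); apply: eq_bigr => k _; rewrite tnth_linsubst; congr (_ ^+ _).
by apply: eq_bigr => l _; rewrite !mxE.
Qed.

Lemma pulled_back_coef s z :
  s \in msupp F -> (pulled_back z)@_s = composite ev r F@_s z.
Proof.
move=> sF; rewrite raddf_sum (bigD1_seq s) ?msupp_uniq //=.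
rewrite mcoeffZ mcoeffX eqxx mulr1 big1 ?addr0 // => t ts.
by rewrite mcoeffZ mcoeffX (negbTE ts) mulr0.
Qed.

Lemma msize_transformed z : (msize (transformed ev r F z) <= msize F)%N.
Proof.
rewrite transformedE; apply: leq_trans (leq_msize_comp _ _) _.
  by move=> k; apply: msize_linsubst.
apply: leq_msize_sum => s sF; apply: leq_msizeZ; rewrite msizeX.
exact: msize_mdeg_lt.
Qed.

(** Undoing the linear change of jets turns (B) back into (A). *)
Lemma pulled_backE (hr : jacobian_mx r \in unitmx) V :
  generically V (fun z => transformed ev r F z
    \mPo linsubst (eval_mx (invmx (chain_mx r N)) z) = pulled_back z).
Proof.
have h := generically_eval_mxM V (chain_mx r N) (invmx (chain_mx r N)).
rewrite mulmxV ?chain_mx_unit // in h.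
apply: generically_mono2 h (generically_eval_mx1 V N) => z _ hz h1.
by rewrite transformedE linsubstM hz h1 linsubst1.
Qed.

End Transformed.

Theorem theorem5p3 (R : realType) (n : nat)
    (L : fieldExtType (ratfun R n))
    (m : nat) (delta : m.-tuple L) (e : 'I_m -> nat)
    (htower : radical_tower delta e)
    (U : set (cspace R n)) (ev : L -> cspace_fun R n)
    (hev : branches U ev)
    (N : nat) (F : {mpoly L[jetdim n N]})
    (r : 'I_n -> ratfun R n)
    (hr : jacobian_mx r \in unitmx)
    (V : set (cspace R n)) (hV : cdomain V)
    (hVU : generically V (fun z => U (subst_pt r z))) :
  algebraic_pde V (transformed ev r F) <->
  {in nonrational_coefs F,
     forall a : L, rational_on V (composite ev r a)}.
Proof.
split=> [algB a /mapP[s] | ratA].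
  rewrite mem_filter => /andP[_ sF] ->.
  have := algebraic_comp_linsubst (invmx (chain_mx r N))
    (msize_transformed ev r F) algB.
  move=> /(eq_algebraic (pulled_backE ev F hr V))/(_ s).
  apply: eq_rational_on; apply: generically_true => z.
  by rewrite pulled_back_coef.
apply: algebraic_sum => s sF; apply: algebraicZ.
  have [Fs|Fs] := boolP (F@_s \in 1%VS).
    exact: (rational_on_composite hr hVU hev).
  by apply: ratA; apply/mapP; exists s; rewrite // mem_filter Fs.
apply: algebraic_prod => k; apply: algebraicX.
apply: algebraic_sum => l _; apply: algebraicZ; last exact: algebraic_const.
by eexists; apply: represents_val.
Qed.
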